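(* Let $G$ be a finite simple graph that contains no subdivision of $K_5$ as a subgraph. Then $\tau(G) \leq 2\nu(G)$.
   Context: $\nu(G)$ is the maximum number of pairwise edge-disjoint triangles in $G$. $\tau(G)$ is the minimum size of an edge set $Y \subseteq E(G)$ such that $G - Y$ is triangle-free. *)

(* Defs.v *)
(* A finite simple graph is a symmetric irreflexive
   relation e : rel T on a finite vertex type T. *)
From mathcomp Require Import all_boot.
Set Implicit Arguments. Unset Strict Implicit. Unset Printing Implicit Defensive.

Section Graphs.
Variable T : finType.

Definition edges (r : rel T) : {set {set T}} :=
  [set [set x; y] | x in T, y in T & r x y].

Definition triangle (r : rel T) (t : {set T}) : bool :=
  (#|t| == 3) && [forall x in t, forall y in t, (x != y) ==> r x y].

Definition tri_edges (t : {set T}) : {set {set T}} :=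
  [set [set x; y] | x in t, y in t & x != y].

Definition tri_packing (r : rel T) (S : {set {set T}}) : bool :=
  [forall t in S, triangle r t] &&
  [forall t1 in S, forall t2 in S,
     (t1 != t2) ==> (tri_edges t1 :&: tri_edges t2 == set0)].

Definition nu (r : rel T) : nat :=
  \max_(S : {set {set T}} | tri_packing r S) #|S|.

Definition del_edges (r : rel T) (Y : {set {set T}}) : rel T :=
  fun x y => r x y && ([set x; y] \notin Y).

Definition triangle_free (r : rel T) : bool :=
  [forall t : {set T}, ~~ triangle r t].

Definition tri_transversal (r : rel T) (Y : {set {set T}}) : bool :=
  (Y \subset edges r) && triangle_free (del_edges r Y).

(* tau(G): minimum size of such Y. The default value #|edges r| is attained
   by Y = edges r, which is always a transversal, so this is the true minimum. *)
Definition tau (r : rel T) : nat :=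
  \big[minn/#|edges r|]_(Y : {set {set T}} | tri_transversal r Y) #|Y|.

(* r contains a subdivision of K_5 as a subgraph: 5 distinct branch vertices
   b i, and for every pair i < j a path from b i to b j whose (listed) internal
   vertices P i j are distinct, avoid all branch vertices, and are disjoint
   from the internal vertices of every other such path. *)
Definition has_K5_subdivision (r : rel T) : Prop :=
  exists (b : 'I_5 -> T) (P : 'I_5 -> 'I_5 -> seq T),
    injective b /\
    (forall i j : 'I_5, i < j ->
       [/\ path r (b i) (rcons (P i j) (b j)),
           uniq (P i j) &
           forall k : 'I_5, b k \notin P i j]) /\
    (forall i j i' j' : 'I_5, i < j -> i' < j' -> (i, j) <> (i', j') ->
       forall x, x \in P i j -> x \notin P i' j').

End Graphs.

(* Main.v *)
(* The link of a vertex v of a graph without TK_5 has no TK_4. A graph L without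
   TK_4 has a matching M and a vertex set C with |C| <= |M| such that every edge of
   L is in M or meets C. Applied to the link of v, the |M| triangles v + m (m in M)
   are edge-disjoint, and the edges of M together with the edges vc (c in C), at
   most 2|M| in number, meet every triangle through v; induction applies to the
   graph obtained by deleting v and M.

   The pair (M, C) is found by eliminating vertices of degree at most two, which
   exist in graphs without TK_4. Eliminating v with neighbours x and y puts on the
   pair xy a label that stands for a small two-terminal graph at least as hard to
   solve; five labels suffice, by a finite computation. *)
Require Import Defs.
From mathcomp Require Import all_boot all_algebra.
From mathcomp Require Import zify.
Set Implicit Arguments. Unset Strict Implicit. Unset Printing Implicit Defensive.

(** * Subdivisions of complete graphs *)

Section Subdivisions.
Variable T : finType.
Implicit Types (r : rel T) (p s : seq T).

(** For [n = 5] this unfolds to [has_K5_subdivision]; a general [n] is needed to pass between $K_4$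
    in a link and $K_5$ in the graph. *)
Definition has_Kn_subdivision n r : Prop :=
  exists (b : 'I_n -> T) (P : 'I_n -> 'I_n -> seq T),
    injective b /\
    (forall i j : 'I_n, i < j ->
       [/\ path r (b i) (rcons (P i j) (b j)),
           uniq (P i j) &
           forall k : 'I_n, b k \notin P i j]) /\
    (forall i j i' j' : 'I_n, i < j -> i' < j' -> (i, j) <> (i', j') ->
       forall x, x \in P i j -> x \notin P i' j').

Lemma has_Kn_subdivision_sub n r r' :
  subrel r r' -> has_Kn_subdivision n r -> has_Kn_subdivision n r'.
Proof.
move=> rr' [b [P [b_inj [pathP disjP]]]]; exists b, P; split=> //; split=> //.
by move=> i j /pathP[pP uP bP]; split=> //; apply: sub_path pP.
Qed.

(** * Links and the cone over a subdivision *)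

Definition link r v : rel T := fun x y => [&& r v x, r v y & r x y].

Lemma link_path r v x p : path (link r v) x p -> p != [::] -> all (r v) (x :: p).
Proof.
elim: p x => [|y p IHp] x //= /andP[/and3P[vx vy _] yp] _; rewrite vx vy /=.
by case: p IHp yp => // z p IHp yp; have /andP[] := IHp _ yp isT.
Qed.

(** The vertex [v] becomes branch vertex 0, joined by single edges to the old branch vertices.
    Vertices outside the neighbourhood of [v] are isolated in the link, so everything on a path with
    an edge is adjacent to [v]; with at least two branch vertices, each of them is an end of such a
    path. *)
Lemma link_Kn_subdivision n r v : symmetric r -> irreflexive r ->
  has_Kn_subdivision n.+2 (link r v) -> has_Kn_subdivision n.+3 r.
Proof.
move=> r_sym r_irr [b [P [b_inj [pathP disjP]]]].
have inN (i j : 'I_n.+2) x : i < j -> x \in b i :: rcons (P i j) (b j) -> r v x.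
  move=> /pathP[pP _ _]; apply/allP: x; apply: link_path pP _.
  by case: (P i j).
have bN i : r v (b i).
  have [i0 | i_gt0] := posnP i.
    have lti1 : i < (inord 1 : 'I_n.+2) by rewrite i0 inordK.
    by apply: inN lti1 _; rewrite mem_head.
  have lt0i : (ord0 : 'I_n.+2) < i by [].
  by apply: inN lt0i _; rewrite inE mem_rcons mem_head orbT.
have PN (i j : 'I_n.+2) x : i < j -> x \in P i j -> r v x.
  by move=> ltij xP; apply: inN ltij _; rewrite inE mem_rcons inE xP !orbT.
exists (fun i => if unlift ord0 i is Some i' then b i' else v).
exists (fun i j => if unlift ord0 i is Some i' then
          if unlift ord0 j is Some j' then P i' j' else [::] else [::]).
have vb i : b i != v by apply: contraTneq (bN i) => ->; rewrite r_irr.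
split; last split.
- move=> i j; case: unliftP => [i'|] ->; case: unliftP => [j'|] -> //.
  + by move/b_inj->.
  + by move/eqP; rewrite (negPf (vb _)).
  + by move/esym/eqP; rewrite (negPf (vb _)).
- move=> i j; case: unliftP => [i'|] ->; case: unliftP => [j'|] -> //=; last first.
    by rewrite bN.
  rewrite /bump /= !add1n ltnS => ltij; have [pP uP bP] := pathP _ _ ltij.
  split=> //; first by apply: sub_path pP => x y /and3P[].
  move=> k; case: unliftP => [k'|] _ //.
  by apply/negP => /(PN _ _ _ ltij); rewrite r_irr.
- move=> i j i' j'.
  case: (unliftP ord0 i) => [i1|] ->; case: (unliftP ord0 j) => [j1|] ->; rewrite ?in_nil //.
  case: (unliftP ord0 i') => [i2|] ->; case: (unliftP ord0 j') => [j2|] -> //.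
  rewrite /= /bump /= !add1n !ltnS => lt1 lt2 ne x; apply: disjP => //.
  by case=> ei ej; apply: ne; rewrite ei ej.
Qed.

(** The shape that arises along a longest path: three of the six branch paths are single edges. *)
Lemma K4_intro r b0 b1 b2 b3 p01 p23 p13 :
    uniq ([:: b0; b1; b2; b3] ++ p01 ++ p23 ++ p13) ->
    path r b0 (rcons p01 b1) -> r b0 b2 -> r b0 b3 -> r b1 b2 ->
    path r b1 (rcons p13 b3) -> path r b2 (rcons p23 b3) ->
  has_Kn_subdivision 4 r.
Proof.
move=> U h01 h02 h03 h12 h13 h23.
exists (fun i => nth b0 [:: b0; b1; b2; b3] i).
exists (fun i j => match nat_of_ord i, nat_of_ord j with
  | 0, 1 => p01 | 1, 3 => p13 | 2, 3 => p23 | _, _ => [::] end).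
move: U; rewrite cat_uniq => /and3P[Ub /hasPn Ubp].
rewrite !cat_uniq => /and3P[U01 /hasPn d1 /and3P[U23 /hasPn d2 U13]].
have dis1 x : x \in p01 -> (x \notin p23) * (x \notin p13).
  move=> xp; split; apply: contraL xp => xq; apply: d1; rewrite mem_cat xq //.
  exact: orbT.
have dis2 x : x \in p23 -> x \notin p13 by apply: contraL => /d2.
have nb (k : 'I_4) x : x \in p01 ++ p23 ++ p13 -> nth b0 [:: b0; b1; b2; b3] k != x.
  by move=> /Ubp; apply: contraNneq => <-; apply: mem_nth.
split; last split.
- by move=> i j /eqP; rewrite (nth_uniq b0) // => /eqP/val_inj.
- case=> [[|[|[|[|//]]]] hi] [[|[|[|[|//]]]] hj] //= _;
    rewrite ?h01 ?h02 ?h03 ?h12 ?h13 ?h23; split=> // k;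
    by apply/negP => kp; apply/negP: (eqxx (nth b0 [:: b0; b1; b2; b3] k));
       apply: nb; rewrite !mem_cat kp ?orbT.
- case=> [[|[|[|[|//]]]] hi] [[|[|[|[|//]]]] hj] [[|[|[|[|//]]]] hi'];
    case=> [[|[|[|[|//]]]] hj'] //= _ _ ne x; rewrite ?in_nil //;
    try (by case: ne; congr pair; apply: val_inj).
  + by move/dis1=> ->.
  + by move/dis1=> ->.
  + by apply: contraL => /dis1 ->.
  + by apply: contraL => /dis1 ->.
Qed.

(* A path through the new edge [x y] is rerouted through the suppressed [v]. *)
Lemma path_suppress r r' v x y a p c :
    (forall a b, r' a b -> r a b \/ [set a; b] = [set x; y]) ->
    symmetric r -> r x v -> r v y ->
    path r' a (rcons p c) -> uniq (a :: rcons p c) ->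
  path r a (rcons p c) \/
  {subset [:: x; y] <= a :: rcons p c} /\
    (exists2 p', path r a (rcons p' c) & perm_eq p' (v :: p)).
Proof.
move=> r'E r_sym xv vy.
have edgeP a1 b1 : r' a1 b1 -> r a1 b1 \/
    [/\ r a1 v, r v b1, a1 = x \/ a1 = y & {subset [:: x; y] <= [:: a1; b1]}].
  move=> /r'E [|E]; [by left | right].
  have: a1 \in [set x; y] by rewrite -E set21.
  have: b1 \in [set x; y] by rewrite -E set22.
  have xi: x \in [set a1; b1] by rewrite E set21.
  have yi: y \in [set a1; b1] by rewrite E set22.
  have sub: {subset [:: x; y] <= [:: a1; b1]}.
    by move=> z; rewrite !inE => /orP[]/eqP->; [move: xi | move: yi]; rewrite !inE.
  by rewrite !inE => /orP[]/eqP b1E /orP[]/eqP a1E; split=> //;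
    rewrite ?a1E ?b1E ?(r_sym y) // ?(r_sym _ x) //; auto.
elim: p a => [|d p IHp] a /=.
  rewrite andbT => /edgeP[ac|[av vc _ xyi]] _; [by left; rewrite ac | right].
  by split=> //; exists [:: v]; rewrite //= av vc.
case/andP=> ad pd /andP[ai ui]; have [pr|[xyi [p' pr' pp']]] := IHp d pd ui.
  case/edgeP: ad => [ad|[av vd _ xyi]]; [by left; rewrite ad | right]; split.
    by move=> z /xyi; rewrite !inE => /orP[] ->; rewrite ?orbT.
  by exists [:: v, d & p]; rewrite //= av vd.
case/edgeP: ad => [ad|[_ _ aE _]]; last first.
  by case/negP: ai; case: aE => ->; apply: xyi; rewrite !inE eqxx ?orbT.
right; split; first by move=> z /xyi zi; rewrite in_cons zi orbT.
exists (d :: p'); rewrite /= ?ad //.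
by rewrite (perm_trans (_ : perm_eq _ (d :: v :: p))) ?perm_cons // (perm_catCA [:: d] [:: v]).
Qed.

Lemma suppress_Kn_subdivision n r r' v x y :
    (forall a b, r' a b -> [/\ a != v, b != v & r a b \/ [set a; b] = [set x; y]]) ->
    symmetric r -> r x v -> r v y -> x != y ->
  has_Kn_subdivision n r' -> has_Kn_subdivision n r.
Proof.
move=> r'E r_sym xv vy xNy [b [P [b_inj [pathP disjP]]]].
pose full i j := b i :: rcons (P i j) (b j).
have r'E' a c : r' a c -> r a c \/ [set a; c] = [set x; y] by case/r'E.
have fullU (i j : 'I_n) : i < j -> uniq (full i j).
  move=> ltij; have [_ uP bP] := pathP _ _ ltij.
  rewrite /= mem_rcons inE negb_or bP rcons_uniq bP uP !andbT.
  by apply: contraTneq ltij => /b_inj ->; rewrite ltnn.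
have vN (i j : 'I_n) : i < j -> v \notin full i j.
  move=> /pathP[pP _ _]; rewrite /full.
  elim: (P i j) (b i) pP => [|d p IHp] a /=.
    by rewrite andbT => /r'E[av bv _]; rewrite !inE negb_or ![v == _]eq_sym av.
  by case/andP=> /r'E[av _ _] /IHp h; rewrite in_cons negb_or [v == a]eq_sym av.
have sub_eq (i j i' j' : 'I_n) : i < j -> i' < j' -> {subset [:: x; y] <= full i j} ->
    {subset [:: x; y] <= full i' j'} -> (i, j) = (i', j').
  move=> lt1 lt2 s1 s2; apply/eqP; apply: contraT => /eqP ne.
  have common z : z \in full i j -> z \in full i' j' ->
      exists2 k, z = b k & ((k == i) || (k == j)) && ((k == i') || (k == j')).
    have [_ _ b1] := pathP _ _ lt1; have [_ _ b2] := pathP _ _ lt2.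
    rewrite !inE !mem_rcons !inE.
    have mid1 : z \in P i j -> z \notin P i' j' by apply: disjP.
    case/or3P => [/eqP zi|/eqP zj|zP].
    - rewrite zi !(inj_eq b_inj) (negPf (b2 _)) orbF => h.
      by exists i; rewrite ?eqxx.
    - rewrite zj !(inj_eq b_inj) (negPf (b2 _)) orbF => h.
      by exists j; rewrite ?eqxx ?orbT.
    - rewrite (negPf (mid1 zP)) orbF => /orP[]/eqP zE; move: zP; rewrite zE => zP.
      + by have := b1 i'; rewrite zP.
      + by have := b1 j'; rewrite zP.
  have xi : x \in [:: x; y] by rewrite mem_head.
  have yi : y \in [:: x; y] by rewrite !inE eqxx orbT.
  have [k xE /andP[k1 k2]] := common x (s1 _ xi) (s2 _ xi).
  have [l yE /andP[l1 l2]] := common y (s1 _ yi) (s2 _ yi).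
  have kl : k != l by apply: contraNneq xNy => kl; rewrite xE yE kl.
  case: ne; have: (i : nat, j : nat) = (i' : nat, j' : nat).
    by move: k1 k2 l1 l2 kl; rewrite -!val_eqE /= => k1 k2 l1 l2 kl; congr pair; lia.
  by case=> /val_inj -> /val_inj ->.
have [/existsP[i0 /existsP[j0 /andP[lt0 bad]]]|good] :=
    boolP [exists i : 'I_n, exists j : 'I_n,
      (i < j) && ~~ path r (b i) (rcons (P i j) (b j))]; last first.
  exists b, P; split=> //; split=> // i j ltij; have [_ uP bP] := pathP _ _ ltij.
  split=> //; apply: contraNT good => badij.
  by apply/existsP; exists i; apply/existsP; exists j; rewrite ltij.
have [pP0 uP0 bP0] := pathP _ _ lt0.
have [pr|[xy0 [p' p'P pp']]] := path_suppress r'E' r_sym xv vy pP0 (fullU _ _ lt0).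
  by rewrite pr in bad.
exists b, (fun i j => if (i, j) == (i0, j0) then p' else P i j).
have vNP (i j : 'I_n) : i < j -> v \notin P i j.
  by move=> /vN; rewrite inE mem_rcons inE !negb_or => /and3P[].
split=> //; split=> [i j ltij | i j i' j' lt1 lt2 ne z].
  case: eqP => [[-> ->]|ne].
    split=> //; first by rewrite (perm_uniq pp') /= uP0 vNP.
    move=> k; rewrite (perm_mem pp') inE negb_or bP0 andbT.
    (* Every branch vertex is an end of a path of the old system, paired with [i0] or [j0], and such
       paths avoid [v]. *)
    have [lt|lt|/val_inj ->] := ltngtP k i0;
      [have := vN _ _ lt | have := vN _ _ lt | have := vN _ _ lt0];
      by rewrite !inE ?mem_rcons ?inE !negb_or ![v == _]eq_sym => /and3P[].
  have [pP uP bP] := pathP _ _ ltij; split=> //.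
  have [//|[xy _]] := path_suppress r'E' r_sym xv vy pP (fullU _ _ ltij).
  by case: ne; apply: sub_eq.
case: eqP => [e1|ne1]; case: eqP => [e2|ne2]; rewrite ?(perm_mem pp') ?inE.
- by case: ne; rewrite e1 e2.
- case/orP=> [/eqP->|]; first exact: vNP.
  by apply: disjP => //; rewrite -e1.
- move=> zP; rewrite negb_or; apply/andP; split.
    by apply: contraTneq zP => ->; apply: vNP.
  by move: zP; apply: disjP => //; rewrite -e2.
- exact: disjP.
Qed.

(** * Longest paths and vertices of small degree *)

Definition upath r s : bool := uniq s && sorted r s.

(* Here [w] carries all the neighbours of the first vertex [a] of a longest path.
   Let [y3] be the last neighbour and [y2] another one, with predecessor [a1].
   Reversing the part before [y2] gives a longest path starting at [a1]: either
   its neighbours occur earlier than [y3] (induction), or [a1] has a neighbour [z]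
   from [y3] on, and [a, a1, y2, y3] are the branch vertices of a [K_4]. *)
Lemma longest_upath_K4 r a w c : symmetric r -> irreflexive r ->
    (forall x y, r x y -> 2 < #|[set z | r x z]|) ->
    upath r (a :: w ++ c) -> 1 < size (a :: w ++ c) ->
    (forall s, upath r s -> size s <= size (a :: w ++ c)) ->
    (forall z, r a z -> z \in w) ->
  has_Kn_subdivision 4 r.
Proof.
move=> r_sym r_irr deg3.
elim: (size w) {-2}w (erefl (size w)) a c => [|k IHk] {}w sw a c.
  case: w sw => // _ /andP[_]; case: c => // d c /= /andP[ad _] _ _ /(_ d).
  by move/(_ ad).
case/lastP: w sw => // w y3; rewrite size_rcons => -[sw] up s1 maxs sub.
have [ay3|nay3] := boolP (r a y3); last first.
  apply: (IHk w sw a (y3 :: c)); rewrite -?cat_rcons //.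
  move=> z az; have := sub z az; rewrite mem_rcons inE => /orP[/eqP zy|//].
  by rewrite -zy az in nay3.
rewrite cat_rcons in up s1 maxs.
case: w => [|a' w] in sw up s1 maxs sub *.
  have := deg3 _ _ ay3; suff /subset_leq_card : [set z | r a z] \subset [set y3].
    by rewrite cards1 => h1 h2; have := leq_trans h2 h1.
  by apply/subsetP => z; rewrite !inE => /sub; rewrite inE.
have [y2 ay2 y2w] : exists2 y2, r a y2 & y2 \in w.
  have /subsetPn[y2] : ~~ ([set z | r a z] \subset [set a'; y3]).
    apply/negP => /subset_leq_card h; have := leq_trans (deg3 _ _ ay3) h.
    by rewrite cards2; case: (_ == _).
  rewrite !inE negb_or => ay2 /andP[n1 n2]; exists y2 => //.
  by have := sub y2 ay2; rewrite mem_rcons !inE (negPf n1) (negPf n2).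
case/splitPr: y2w => A B in sw up s1 maxs sub *.
have {}E : (a' :: A ++ y2 :: B) = rcons (belast a' A) (last a' A) ++ y2 :: B.
  by rewrite -lastI.
move: (belast a' A) (last a' A) E => A' a1 E.
rewrite {}E in sw up s1 maxs; clear sub; clear A; rename A' into A.
(* The prefix of the reversed path ends just before [y3], so it is one shorter than the old one and
   the induction applies. *)
have sw' : size (rev A ++ [:: a, y2 & B]) = k.
  by rewrite -sw !size_cat size_rcons size_rev /= addSnnS.
have sE : perm_eq (a1 :: (rev A ++ [:: a, y2 & B]) ++ y3 :: c)
                  (a :: (rcons A a1 ++ y2 :: B) ++ y3 :: c).
  apply/permP => P; rewrite /= -!cats1 !count_cat count_rev /=.
  by rewrite ?count_cat /=; lia.
have us : uniq (a :: (rcons A a1 ++ y2 :: B) ++ y3 :: c) by case/andP: up.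
move: up; rewrite /upath /= -catA /= cat_path last_rcons => /and3P[uas1 pA].
rewrite /= cat_path => /and3P[a1y2 pB] /= /andP[By3 pc].
have revA : path r a1 (rcons (rev A) a).
  have := rev_path r a (rcons A a1); rewrite last_rcons belast_rcons rev_cons => ->.
  by rewrite (eq_path (e' := r)).
have us' : upath r (a1 :: (rev A ++ [:: a, y2 & B]) ++ y3 :: c).
  rewrite /upath (perm_uniq sE) /= -catA uas1 /= -(cat_rcons a) !cat_path revA.
  by rewrite last_cat last_rcons /= ay2 pB By3 pc.
have smax s : upath r s -> size s <= size (a1 :: (rev A ++ [:: a, y2 & B]) ++ y3 :: c).
  by rewrite (perm_size sE); apply: maxs.
have [/forall_inP all1|] := boolP [forall z in r a1, z \in rev A ++ [:: a, y2 & B]].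
  by apply: (IHk _ sw' a1 (y3 :: c)) => //; rewrite (perm_size sE).
rewrite negb_forall_in => /exists_inP[z a1z zN].
have {}a1z : r a1 z := a1z.
(* By maximality [z] lies on the path, at [y3] or after it. [D] jumps from [a1] to [z] and walks
   back to [y3]; [c1] is the segment it uses, hence disjoint from [A] and [B]. *)
have [D pD DP] : exists2 D, path r a1 (rcons D y3) &
    exists2 c1, perm_eq (y3 :: D) c1 & exists c2, y3 :: c = c1 ++ c2.
  have: z \in y3 :: c.
    apply: contraT => zNc; have := smax [:: z, a1 & (rev A ++ [:: a, y2 & B]) ++ y3 :: c].
    rewrite /= ltnn; apply; move: us'; rewrite /upath /= => /andP[-> ->].
    rewrite inE mem_cat negb_or negb_or zN zNc [r z a1]r_sym a1z !andbT.
    by apply: contraTneq a1z => ->; rewrite r_irr.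
  rewrite inE => /predU1P[zE|].
    rewrite zE in a1z; by exists [::]; rewrite /= ?andbT //; exists [:: y3] => //; exists c.
  move=> zc; case/splitPr: zc pc => c1 c2; rewrite cat_path /= => /and3P[pc1 lz _].
  exists (z :: rev c1).
    rewrite /= a1z /=.
    have := rev_path r y3 (rcons c1 z); rewrite last_rcons belast_rcons rev_cons => ->.
    by rewrite (eq_path (e' := r)) // rcons_path pc1.
  exists (y3 :: rcons c1 z); last by exists c2; rewrite /= cat_rcons.
  by rewrite perm_cons perm_sym perm_rcons perm_cons perm_sym perm_rev.
case: DP => c1 Dc1 [c2 cE].
apply: (@K4_intro r a a1 y2 y3 A B D) => //.
  move: us; rewrite cE (catA _ c1) -(cat_cons a (_ ++ c1)) cat_uniq => /andP[us _].
  have DE : perm_eq ([:: a; a1; y2; y3] ++ A ++ B ++ D) (a :: (rcons A a1 ++ y2 :: B) ++ c1).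
    apply: (@perm_trans _ (a :: (rcons A a1 ++ y2 :: B) ++ y3 :: D)).
      apply/permP => P; rewrite -!cats1 /= !count_cat /= ?count_cat /=.
      set x0 := count P A; set x1 := count P B; set x2 := count P D; clear -x0; lia.
    by rewrite perm_cons perm_cat2l.
  by rewrite (perm_uniq DE).
by rewrite rcons_path pB By3.
Qed.

(** Otherwise every non-isolated vertex has degree at least three. All neighbours of the first
    vertex of a longest path lie on that path, so [longest_upath_K4] yields a subdivided $K_4$; the
    edge [x y] makes the path long enough. *)
Lemma small_degree r : symmetric r -> irreflexive r -> ~ has_Kn_subdivision 4 r ->
  forall x y, r x y -> exists2 v, (exists z, r v z) & #|[set z | r v z]| <= 2.
Proof.
move=> r_sym r_irr nK4 x y xy.
have [/existsP[v /andP[/existsP[z vz] v2]]|no] :=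
    boolP [exists v, [exists z, r v z] && (#|[set z | r v z]| <= 2)].
  by exists v => //; exists z.
have deg3 v z : r v z -> 2 < #|[set z | r v z]|.
  move=> vz; rewrite ltnNge; apply: contra no => v2.
  by apply/existsP; exists v; rewrite v2 andbT; apply/existsP; exists z.
pose Q n := [exists s : n.-tuple T, upath r s].
have Qs s : upath r s -> Q (size s) by move=> us; apply/existsP; exists (in_tuple s).
have Q2 : Q 2.
  apply: (Qs [:: x; y]); rewrite /upath /= inE xy !andbT.
  by apply: contraTneq xy => ->; rewrite r_irr.
have Qmax n : Q n -> n <= #|T|.
  case/existsP => s /andP[us _]; rewrite -(size_tuple s) -(card_uniqP us).
  exact: max_card.
have [n /existsP[s us] nmax] := ex_maxnP (ex_intro _ 2 Q2) Qmax.
have ns : 1 < size s by rewrite size_tuple; apply: nmax.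
have smax s' : upath r s' -> size s' <= size s.
  by move/Qs/nmax; rewrite size_tuple.
case: nK4; case: (tval s) us ns smax => // a p us ns smax.
apply: (@longest_upath_K4 r a p [::]); rewrite ?cats0 // => z az.
apply: contraT => zp; have := smax [:: z, a & p].
rewrite /= ltnn; apply; move: us; rewrite /upath /= => /andP[-> ->].
rewrite inE negb_or zp [r z a]r_sym az !andbT.
by apply: contraTneq az => ->; rewrite r_irr.
Qed.
End Subdivisions.

(** * Eliminating vertices of degree at most two *)

(* A label on a pair [x, y] stands for a graph attached to the rest at [x] and [y]:
   [Ledge]: the edge [xy]; [Lkite]: the edge [xv] and the triangle [v u y];
   [Lkite']: its mirror image; [Ltwin]: the edge [xy] and the triangles [x u v],
   [v w y]. These few graphs were found by computer: up to replacement by a worse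
   graph, they are closed under the elimination step below. *)
Inductive label := Lnone | Ledge | Lkite | Lkite' | Ltwin.

Definition is_none l := if l is Lnone then true else false.

Definition swap l := match l with Lkite => Lkite' | Lkite' => Lkite | _ => l end.

(* The boolean [c] says that the first end is in the cover, [m] that it may be
   matched inside the attached graph; [c'] and [m'] are the same for the second
   end. Outside the cover, two vertices may be adjacent only if matched together. *)
Definition feas l (c m c' m' : bool) : bool :=
  match l with Ledge | Ltwin => [|| c, c' | m && m'] | _ => true end.

(* One plus the best value, over the interior of the attached graph, of the number
   of matching edges minus the number of covering vertices; the offset keeps it in
   [nat]. The values are irrelevant where [feas] is false. *)
Definition kite_gain (c m c' m' : bool) : nat :=
  match c, m, c', m' with
  | true, false, true, _ => 2
  | true, false, false, false => 0
  | true, false, false, true => 1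
  | true, true, true, _ => 2
  | true, true, false, false => 0
  | true, true, false, true => 2
  | false, _, false, false => 0
  | false, false, _, _ => 1
  | false, true, true, b => if b then 2 else 1
  | false, true, false, true => 2
  end.

Definition gain l (c m c' m' : bool) : nat :=
  match l with
  | Lnone => 1
  | Ledge => if m && m' then 2 else 1
  | Lkite => kite_gain c m c' m'
  | Lkite' => kite_gain c' m' c m
  | Ltwin =>
    match c, m, c', m' with
    | true, false, true, b => if b then 2 else 1
    | true, false, false, b => if b then 2 else 0
    | true, true, true, _ => 2
    | true, true, false, b => if b then 2 else 1
    | false, false, true, b => if b then 1 else 0
    | false, true, true, _ => 2
    | false, _, false, _ => 0
    end
  end.

(* A vertex with flag [h] is in the cover, unmatched and free of charge: it stands
   for a vertex with a pendant edge, which pays for it. *)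
Definition cost (h c : bool) : nat := c && ~~ h.

(* For a neighbour [x] of the eliminated vertex [v]: is it matched into the
   remaining pair [x y], is it matched into the pair [x v]? *)
Definition outer_moves (h h' m : bool) :=
  if h' && ~~ h then [:: (false, false); (true, false); (false, true)]
  else if m then [:: (true, false); (false, true)] else [:: (false, false)].

(* For [v] itself: is it in the cover, is it matched towards [x], towards [y]? *)
Definition inner_moves (h : bool) :=
  if h then [:: (true, (false, false))]
  else [:: (true, (true, false)); (true, (false, true));
           (false, (true, false)); (false, (false, true))].

(** The term [+ 2] balances the offsets of [gain]: three gains stand on the right, only one on the
    left. *)
Definition extends l1 l2 l4 (hv hx hy : bool) l5 (hx' hy' tx mx ty my : bool) :=
  has (fun ox => has (fun oy => has (fun ov =>
    [&& feas l1 tx ox.2 ov.1 ov.2.1, feas l2 ov.1 ov.2.2 ty oy.2,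
        feas l4 tx ox.1 ty oy.1 &
        gain l5 tx mx ty my + cost hx tx + cost hy ty + cost hv ov.1 + 2 <=
        gain l1 tx ox.2 ov.1 ov.2.1 + gain l2 ov.1 ov.2.2 ty oy.2 +
        gain l4 tx ox.1 ty oy.1 + cost hx' tx + cost hy' ty])
   (inner_moves hv)) (outer_moves hy hy' my)) (outer_moves hx hx' mx).

Definition bools := [:: true; false].
Definition labels := [:: Lnone; Ledge; Lkite; Lkite'; Ltwin].

(* Eliminating [v], joined to [x] and [y] by [l1] and [l2], where [x] and [y] are
   joined by [l4]: every solution with the new label [l5] and the new flags extends
   to the old graph without loss. *)
Definition simulates l1 l2 l4 (hv hx hy : bool) l5 (hx' hy' : bool) :=
  [&& ~~ is_none l5 ==> ~~ is_none l4 || (~~ is_none l1 && ~~ is_none l2),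
      hx ==> hx', hy ==> hy',
      hx' ==> [|| hx, ~~ is_none l1 | ~~ is_none l4],
      hy' ==> [|| hy, ~~ is_none l2 | ~~ is_none l4] &
      all (fun tx => all (fun mx => all (fun ty => all (fun my =>
        [&& hx' ==> tx && ~~ mx, hy' ==> ty && ~~ my & feas l5 tx mx ty my] ==>
        extends l1 l2 l4 hv hx hy l5 hx' hy' tx mx ty my)
      bools) bools) bools) bools].

Definition eliminable := all (fun l1 => all (fun l2 => all (fun l4 =>
  all (fun hv => all (fun hx => all (fun hy =>
    has (fun l5 => has (fun hx' => has (fun hy' =>
      simulates l1 l2 l4 hv hx hy l5 hx' hy') bools) bools) labels)
  bools) bools) bools) labels) labels) labels.

(** A computation over 125 triples of labels and 8 triples of flags, each with a search for a new
    label and two new flags. *)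
Lemma eliminableT : eliminable.
Proof. by lazy. Qed.

Lemma all_labels P : all P labels -> forall l, P l.
Proof. by case/and5P=> ? ? ? ? /andP[? _]; case. Qed.

Lemma all_bools P : all P bools -> forall b, P b.
Proof. by case/and3P=> ? ? _; case. Qed.

Lemma has_exists (A : Type) (P : pred A) s : has P s -> exists x, P x.
Proof. by elim: s => //= x s IHs /orP[Px|/IHs //]; exists x. Qed.

Lemma elim_label l1 l2 l4 hv hx hy : exists l5 hx' hy',
  simulates l1 l2 l4 hv hx hy l5 hx' hy'.
Proof.
have := eliminableT.
move/all_labels/(_ l1)/all_labels/(_ l2)/all_labels/(_ l4).
move/all_bools/(_ hv)/all_bools/(_ hx)/all_bools/(_ hy).
by move/has_exists=> [l5 /has_exists[hx' /has_exists[hy' sim]]]; exists l5, hx', hy'.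
Qed.

Lemma outer_movesP (h h' m : bool) o : (h' -> ~~ m) -> (h -> h') -> o \in outer_moves h h' m ->
  [/\ ~~ (o.1 && o.2), h -> o = (false, false), m -> o.1 || o.2 & o.1 || o.2 -> m || h'].
Proof.
case: o => a b; rewrite /outer_moves.
by case: h h' m a b => [] [] [] [] [] //= A B;
  try (by move: (A isT)); try (by move: (B isT)); split.
Qed.

Lemma inner_movesP h o : o \in inner_moves h ->
  ~~ (o.2.1 && o.2.2) /\ (h -> o = (true, (false, false))).
Proof. by case: o => a [b c]; case: h a b c => [] [] [] []. Qed.

Lemma gain_swap l c m c' m' : gain (swap l) c' m' c m = gain l c m c' m'.
Proof. by case: l => //=; case: c c' m m' => [] [] [] []. Qed.

Lemma feas_swap l c m c' m' : feas (swap l) c' m' c m = feas l c m c' m'.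
Proof. by case: l => //=; case: c c' m m' => [] [] [] []. Qed.

Lemma swapK : involutive swap. Proof. by case. Qed.

Lemma is_none_swap l : is_none (swap l) = is_none l. Proof. by case: l. Qed.

(** * Labelled graphs and their solutions *)

Section Config.
Variable T : finType.
(* [t] is the cover; [x] and [y] are matched when [p] points from each to the other. *)
Implicit Types (lab : T -> T -> label) (h t : pred T) (p : T -> option T).

Definition feasible lab h t p :=
  (forall x y, feas (lab x y) (t x) (p x == Some y) (t y) (p y == Some x)) /\
  (forall x, h x -> t x /\ p x = None).

Definition pair_gain lab t p (q : T * T) : int :=
  ((gain (lab q.1 q.2) (t q.1) (p q.1 == Some q.2) (t q.2) (p q.2 == Some q.1))%:Z - 1)%R.

(* Every unordered pair is counted twice. *)
Definition score lab h t p : int :=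
  (\sum_q pair_gain lab t p q - 2 * \sum_x (cost (h x) (t x))%:Z)%R.

Definition solvable lab h := exists t p, feasible lab h t p /\ (0 <= score lab h t p)%R.

Lemma sum_supported (I : finType) (s : seq I) (F G : I -> int) : uniq s ->
    (forall i, i \notin s -> F i = G i) ->
  (\sum_i F i - \sum_i G i = \sum_(i <- s) (F i - G i))%R.
Proof.
move=> us FG; rewrite -GRing.sumrB [RHS]big_uniq // [LHS](bigID (mem s)) /=.
by rewrite [X in (_ + X)%R]big1 ?GRing.addr0 // => i /FG ->; rewrite GRing.subrr.
Qed.

(** The partner of a neighbour of [v] is reset to [y] if [a], to [v] if [b]. The last hypothesis
    ensures that a new partner replaces only [y] or nothing, so no match elsewhere is lost. *)
Lemma repoint (q : option T) (y v : T) (a b : bool) : y != v -> ~~ (a && b) ->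
    (q == Some y -> a || b) -> (a || b -> (q == Some y) || (q == None)) ->
  let q' := if a then Some y else if b then Some v else
            if q == Some v then None else q in
  [/\ (q' == Some y) = a, (q' == Some v) = b &
      forall z, z != y -> z != v -> (q' == Some z) = (q == Some z)].
Proof.
move=> yv; have SE (c d : T) : (Some c == Some d) = (c == d) by [].
case: a b => [] [] //= _ q1 q2.
- split; rewrite ?SE ?eqxx ?(negPf yv) // => z zy zv.
  by rewrite SE eq_sym (negPf zy); case/orP: (q2 isT) => /eqP->;
    rewrite ?SE // eq_sym (negPf zy).
- split; rewrite ?SE ?eqxx ?(eq_sym v) ?(negPf yv) // => z zy zv.
  by rewrite SE eq_sym (negPf zv); case/orP: (q2 isT) => /eqP->;
    rewrite ?SE // eq_sym (negPf zy).
- split; [| |move=> z zy zv]; case: (eqVneq q (Some v)) => [qv|/negPf qv] //.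
  + by apply/negP => /q1.
  + by rewrite qv SE [v == z]eq_sym (negPf zv).
Qed.

(** The label and flags from [elim_label] replace everything at [v]. A solution of the smaller graph
    is changed only at [v], [x] and [y]. The labels to [x] and [y] may be [Lnone], so degrees below
    two are included. *)
Lemma eliminate lab h v x y :
    (forall a b, lab b a = swap (lab a b)) -> (forall a, is_none (lab a a)) ->
    v != x -> v != y -> x != y ->
    (forall z, ~~ is_none (lab v z) -> (z == x) || (z == y)) ->
  exists lab' h',
    [/\ [/\ (forall a b, lab' b a = swap (lab' a b)), (forall a, is_none (lab' a a)),
         ~~ h' v & (forall a, h' a -> h a || [exists b, ~~ is_none (lab a b)])],
        (forall a b, ~~ is_none (lab' a b) -> [/\ a != v, b != v &
          ~~ is_none (lab a b) \/
          [/\ [set a; b] = [set x; y], ~~ is_none (lab x v) & ~~ is_none (lab v y)]]) &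
        solvable lab' h' -> solvable lab h].
Proof.
move=> lab_sym lab_irr vx vy xy nbv.
have [l5 [hx' [hy' sim]]] := elim_label (lab x v) (lab v y) (lab x y) (h v) (h x) (h y).
case/and5P: sim => /implyP l5E /implyP hxx /implyP hyy /implyP hx'E /andP[/implyP hy'E sim].
pose lab' a b := if (a == v) || (b == v) then Lnone else
  if (a == x) && (b == y) then l5 else if (a == y) && (b == x) then swap l5 else lab a b.
pose h' a := if a == v then false else if a == x then hx' else if a == y then hy' else h a.
have yx : y != x by rewrite eq_sym.
have xv : x != v by rewrite eq_sym.
have yv : y != v by rewrite eq_sym.
have lab'_sym a b : lab' b a = swap (lab' a b).
  rewrite /lab' orbC; case: ifP => // _.
  rewrite [(b == x) && _]andbC [(b == y) && _]andbC.
  case: (altP andP) => [[/eqP-> /eqP->]|_]; last by case: ifP; rewrite ?swapK.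
  by rewrite (negPf yx) /= swapK.
have lab'_irr a : is_none (lab' a a).
  rewrite /lab'; case: ifP => // _; case: (eqVneq a x) => [->|_] /=.
    by rewrite (negPf xy) /= lab_irr.
  by rewrite andbF lab_irr.
exists lab', h'; split.
- split=> //.
  + by rewrite /h' eqxx.
  + move=> a; rewrite /h'; case: (a == v) => //; case: eqP => [->|_].
      by case/hx'E/or3P=> [-> //|l|l]; apply/orP; right; apply/existsP; [exists v | exists y].
    case: eqP => [-> /hy'E/or3P[-> //|l|l]|_ -> //]; apply/orP; right; apply/existsP.
      by exists v; rewrite lab_sym is_none_swap.
    by exists x; rewrite lab_sym is_none_swap.
- move=> a b; rewrite /lab'; case: ifP => // /negbT; rewrite negb_or => /andP[av bv].
  case: ifP => [/andP[/eqP-> /eqP->]|_].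
    by move=> /l5E/orP[|/andP[]]; split=> //; [left | right].
  case: ifP => [/andP[/eqP-> /eqP->]|_]; last by split=> //; left.
  rewrite is_none_swap => /l5E/orP[l4|/andP[l1 l2]]; split=> //.
    by left; rewrite lab_sym is_none_swap.
  by right; split=> //; rewrite setUC.
case=> t' [p' [[feas' forced'] score']].
have forcedx : hx' -> t' x && (p' x != Some y).
  by move=> hx1; have [|-> ->] := forced' x; rewrite // /h' (negPf xv) eqxx.
have forcedy : hy' -> t' y && (p' y != Some x).
  by move=> hy1; have [|-> ->] := forced' y; rewrite // /h' (negPf yv) (negPf yx) eqxx.
move: sim => /all_bools/(_ (t' x))/all_bools/(_ (p' x == Some y)).
move=> /all_bools/(_ (t' y))/all_bools/(_ (p' y == Some x))/implyP.
case/(_ _)/hasP.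
  apply/and3P; split; try exact/implyP.
  by have := feas' x y; rewrite /lab' (negPf xv) (negPf yv) !eqxx.
move=> [mxy mxv] ox /hasP[[myx myv] oy /hasP[[tv [mvx mvy]] ov /and4P[/= f1 f2 f4 ineq]]].
have {}forcedx : hx' -> ~~ (p' x == Some y) by case/forcedx/andP.
have {}forcedy : hy' -> ~~ (p' y == Some x) by case/forcedy/andP.
have [/= ox1 ox2 ox3 ox4] := outer_movesP forcedx hxx ox.
have [/= oy1 oy2 oy3 oy4] := outer_movesP forcedy hyy oy.
have [/= ov1 ov2] := inner_movesP ov.
pose t a := if a == v then tv else t' a.
(* The given solution may point to [v], where all labels are [Lnone]; such a stale pointer is
   dropped. *)
pose keep a := if p' a == Some v then None else p' a.
pose p a := if a == v then if mvx then Some x else if mvy then Some y else None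
  else if a == x then if mxy then Some y else if mxv then Some v else keep a
  else if a == y then if myx then Some x else if myv then Some v else keep a
  else p' a.
have [|pxy pxv pxz] := @repoint (p' x) y v mxy mxv yv ox1 ox3.
  case/ox4/orP => [->|hx1] //; have [|_ ->] := forced' x; last by rewrite orbT.
  by rewrite /h' (negPf xv) eqxx.
have [|pyx pyv pyz] := @repoint (p' y) x v myx myv xv oy1 oy3.
  case/oy4/orP => [->|hy1] //; have [|_ ->] := forced' y; last by rewrite orbT.
  by rewrite /h' (negPf yv) (negPf yx) eqxx.
have px : p x = if mxy then Some y else if mxv then Some v else keep x.
  by rewrite /p (negPf xv) eqxx.
have py : p y = if myx then Some x else if myv then Some v else keep y.
  by rewrite /p (negPf yv) (negPf yx) eqxx.
rewrite -/(keep x) -px in pxy pxv pxz; rewrite -/(keep y) -py in pyx pyv pyz.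
have pvx : (p v == Some x) = mvx.
  rewrite /p eqxx; case: (mvx) (mvy) => [] []; rewrite ?eqxx //.
  by rewrite (inj_eq Some_inj) (negPf yx).
have pvy : (p v == Some y) = mvy.
  rewrite /p eqxx; case: (mvx) (mvy) ov1 => [] [] //= _; rewrite ?eqxx //.
  by rewrite (inj_eq Some_inj) (negPf xy).
have tE a : a != v -> t a = t' a by rewrite /t => /negPf ->.
have tv_ : t v = tv by rewrite /t eqxx.
have pE a b : a != v -> b != v -> a != b -> (a, b) != (x, y) -> (a, b) != (y, x) ->
    (p a == Some b) = (p' a == Some b).
  move=> av bv ab; have [->|ax] := eqVneq a x.
    rewrite !xpair_eqE eqxx (negPf xy) /= => b_y _; exact: pxz.
  have [->|ay] := eqVneq a y.
    rewrite !xpair_eqE eqxx (negPf yx) /= => _ bx; exact: pyz.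
  by rewrite /p (negPf av) (negPf ax) (negPf ay).
(* Outside these six ordered pairs the two configurations agree, or both labels are [Lnone]; hence
   the scores differ only on [core] and in the costs of [v], [x], [y]. *)
pose core := [:: (x, y); (y, x); (x, v); (v, x); (v, y); (y, v)].
have far a b : (a, b) \notin core -> is_none (lab a b) /\ is_none (lab' a b) \/
   [/\ lab a b = lab' a b, t a = t' a, t b = t' b,
       (p a == Some b) = (p' a == Some b) & (p b == Some a) = (p' b == Some a)].
  rewrite !inE !negb_or => /and5P[n1 n2 n3 n4 /andP[n5 n6]].
  have [->|ab] := eqVneq a b; first by left.
  have [av|av] := eqVneq a v.
    left; rewrite /lab' av eqxx; split=> //; apply: contraT => /nbv.
    by move: n4 n5; rewrite av !xpair_eqE eqxx /= => /negPf -> /negPf ->.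
  have [bv|bv] := eqVneq b v.
    left; rewrite /lab' bv eqxx orbT; split=> //; rewrite lab_sym is_none_swap.
    apply: contraT => /nbv.
    by move: n3 n6; rewrite bv !xpair_eqE eqxx !andbT => /negPf -> /negPf ->.
  right; rewrite !tE // !pE //; try by rewrite eq_sym.
    by rewrite /lab' (negPf av) (negPf bv) -!xpair_eqE (negPf n1) (negPf n2).
    by move: n2; rewrite !xpair_eqE andbC.
    by move: n1; rewrite !xpair_eqE andbC.
exists t, p; split; first split.
- have none_feas l c m c' m' : is_none l -> feas l c m c' m' by case: l.
  move=> a b; have [|/far[[ab _]|[abE -> -> -> ->]]] := boolP ((a, b) \in core); last first.
  + by rewrite abE; apply: feas'.
  + exact: none_feas.
  have sym c d : feas (lab c d) (t c) (p c == Some d) (t d) (p d == Some c) ->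
      feas (lab d c) (t d) (p d == Some c) (t c) (p c == Some d).
    by rewrite lab_sym feas_swap.
  have fxy : feas (lab x y) (t x) (p x == Some y) (t y) (p y == Some x).
    by rewrite !tE // pxy pyx.
  have fxv : feas (lab x v) (t x) (p x == Some v) (t v) (p v == Some x).
    by rewrite (tE x) // tv_ pxv pvx.
  have fvy : feas (lab v y) (t v) (p v == Some y) (t y) (p y == Some v).
    by rewrite (tE y) // tv_ pyv pvy.
  by rewrite !inE => /or4P[|||/or3P[]] /eqP[-> ->]; rewrite ?fxy ?fxv ?fvy //; apply: sym.
- move=> a ha; have [av|av] := eqVneq a v.
    by move: ha; rewrite av tv_ /p eqxx => /ov2[-> -> ->].
  have [ax|ax] := eqVneq a x.
    move: ha; rewrite ax => hx1; have [|tx1 px1] := forced' x.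
      by rewrite /h' (negPf xv) eqxx hxx.
    by have [m1 m2] := ox2 hx1; rewrite tE // tx1 px m1 m2 /keep px1.
  have [ay|ay] := eqVneq a y.
    move: ha; rewrite ay => hy1; have [|ty1 py1] := forced' y.
      by rewrite /h' (negPf yv) (negPf yx) eqxx hyy.
    by have [m1 m2] := oy2 hy1; rewrite tE // ty1 py m1 m2 /keep py1.
  have [|t1 p1] := forced' a; first by rewrite /h' (negPf av) (negPf ax) (negPf ay).
  by rewrite tE // /p (negPf av) (negPf ax) (negPf ay).
rewrite /score in score' *.
set S := (\sum_q pair_gain lab t p q)%R; set K := (\sum_a (cost (h a) (t a))%:Z)%R.
set S' := (\sum_q pair_gain lab' t' p' q)%R in score'.
set K' := (\sum_a (cost (h' a) (t' a))%:Z)%R in score'.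
have coreU : uniq core.
  rewrite /= !inE !xpair_eqE ?eqxx ?(negPf xy) ?(negPf yx) ?(negPf xv) ?(negPf vx).
  by rewrite ?(negPf yv) ?(negPf vy) /= ?andbF.
have none_gain l c m c' m' : is_none l -> gain l c m c' m' = 1 by case: l.
have farG q : q \notin core -> pair_gain lab t p q = pair_gain lab' t' p' q.
  case: q => a b /far[[n1 n2]|[abE ta tb pa pb]]; rewrite /pair_gain /=.
    by rewrite !none_gain.
  by rewrite abE ta tb pa pb.
have := sum_supported coreU farG; rewrite -/S -/S' /core !big_cons big_nil /pair_gain /=.
have vxyU : uniq [:: v; x; y] by rewrite /= !inE negb_or vx vy xy.
have farC a : a \notin [:: v; x; y] -> ((cost (h a) (t a))%:Z = (cost (h' a) (t' a))%:Z)%R.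
  rewrite !inE !negb_or => /and3P[av ax ay].
  by rewrite tE // /h' (negPf av) (negPf ax) (negPf ay).
have := sum_supported vxyU farC; rewrite -/K -/K' !big_cons big_nil.
rewrite (lab_sym x y) (lab_sym x v) (lab_sym v y) (lab'_sym x y) (lab'_sym x v) (lab'_sym v y).
rewrite !gain_swap (tE x xv) (tE y yv) tv_ pxy pyx pxv pyv pvx pvy.
rewrite [gain (lab' x v) _ _ _ _]none_gain ?[gain (lab' v y) _ _ _ _]none_gain; last 2 first.
- by rewrite /lab' eqxx.
- by rewrite /lab' eqxx orbT.
have -> : lab' x y = l5 by rewrite /lab' (negPf xv) (negPf yv) !eqxx.
have -> : h' x = hx' by rewrite /h' (negPf xv) eqxx.
have -> : h' y = hy' by rewrite /h' (negPf yv) (negPf yx) eqxx.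
have -> : h' v = false by rewrite /h' eqxx.
(* By [gain_swap] each pair of [core] contributes the same in both orders, so the score grows by at
   least twice the slack in [ineq]. *)
move: ineq; set g5 := gain l5 _ _ _ _; set g1 := gain (lab x v) _ _ _ _.
set g2 := gain (lab v y) _ _ _ _; set g4 := gain (lab x y) _ _ _ _.
move: (cost (h v) tv) (cost false _) (cost (h x) _) (cost hx' _) (cost (h y) _) (cost hy' _).
clearbody S S' K K' g1 g2 g4 g5; clear -score'; lia.
Qed.
(** Supplies the two distinct vertices that [eliminate] asks for, filling up with non-neighbours
    when the degree is below two. *)
Lemma pad_pair (A : {set T}) v : 2 < #|T| -> #|A| <= 2 -> v \notin A ->
  exists x y, [/\ v != x, v != y, x != y & forall z, z \in A -> (z == x) || (z == y)].
Proof.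
move=> T3 A2 vA; pose s := enum A ++ enum (~: (v |: A)).
have sz : 1 < size s.
  by have := cardsC (v |: A); rewrite size_cat -!cardE cardsU1 vA -(ltn_add2l 1) addnA => ->.
have us : uniq s.
  rewrite cat_uniq !enum_uniq andbT /=; apply/hasPn => z.
  by rewrite !mem_enum !inE negb_or => /andP[].
have vs : v \notin s by rewrite mem_cat !mem_enum !inE eqxx (negPf vA).
have nv i : i < size s -> v != nth v s i.
  by move=> si; apply: contraNneq vs => {1}->; apply: mem_nth.
exists (nth v s 0), (nth v s 1); split; try by apply: nv; lia.
  by rewrite nth_uniq ?(ltnW sz).
move=> z zA; have zs : z \in s by rewrite mem_cat mem_enum zA.
have : index z s < 2.
  by rewrite index_cat mem_enum zA (leq_trans _ A2) // cardE index_mem mem_enum.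
by rewrite -{2 3}(nth_index v zs); case: (index z s) => [|[|]] //; rewrite eqxx ?orbT.
Qed.

(** Induction on the number of vertices that are flagged or non-isolated. Eliminating [v]
    deactivates it and activates no other vertex; the new graph is a subgraph of the old one or
    arises by suppressing [v], so it still has no subdivided $K_4$. *)
Lemma K4_free_solvable lab h : 2 < #|T| ->
    (forall a b, lab b a = swap (lab a b)) -> (forall a, is_none (lab a a)) ->
    ~ has_Kn_subdivision 4 (fun a b => ~~ is_none (lab a b)) ->
  solvable lab h.
Proof.
move=> T3; pose active (lb : T -> T -> label) (h0 : pred T) :=
  [set a : T | h0 a || [exists b : T, ~~ is_none (lb a b)]].
elim: {lab h}_.+1 {-2}lab {-2}h (ltnSn #|active lab h|) => // n IHn lab h act.
move=> lab_sym lab_irr nK4.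
pose r a b := ~~ is_none (lab a b).
have r_sym : symmetric r by move=> a b; rewrite /r lab_sym is_none_swap.
have r_irr : irreflexive r by move=> a; rewrite /r lab_irr.
have [act0|[a0 a0act]] := set_0Vmem (active lab h).
  have none a b : is_none (lab a b) /\ h a = false.
    have : a \notin active lab h by rewrite act0 inE.
    rewrite inE negb_or => /andP[/negPf-> /existsPn /(_ b)]; by rewrite negbK.
  exists pred0, (fun=> None); split.
    split; last by move=> a; case: (none a a) => _ ->.
    by move=> a b; case: (none a b); case: (lab a b).
  rewrite /score !big1 // => -[a b] _; rewrite /pair_gain /=.
  by case: (none a b); case: (lab a b).
(* Either a flagged isolated vertex, or one given by [small_degree]. *)
have [v vact v2] : exists2 v, v \in active lab h & #|[set z | r v z]| <= 2.
  have [/existsP[v /andP[hv /existsPn vN]]|] := boolP [exists v, h v && ~~ [exists z, r v z]].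
    exists v; first by rewrite inE hv.
    rewrite (_ : [set z | r v z] = set0) ?cards0 //.
    by apply/setP => z; rewrite !inE; apply/negbTE/vN.
  rewrite negb_exists => /forallP/(_ a0) hN.
  have [b a0b] : exists b, r a0 b.
    apply/existsP; move: a0act hN; rewrite inE => /orP[-> /=|//]; by rewrite negbK.
  have [v [z vz] v2] := small_degree r_sym r_irr nK4 a0b.
  by exists v => //; rewrite inE; apply/orP; right; apply/existsP; exists z.
have vN : v \notin [set z | r v z] by rewrite inE r_irr.
have [x [y [vx vy xy nbv]]] := pad_pair T3 v2 vN.
have nbv' z : ~~ is_none (lab v z) -> (z == x) || (z == y).
  by move=> vz; apply: nbv; rewrite inE.
have [lab' [h' [[sym' irr' h'v h'E] lab'E lift]]] := eliminate h lab_sym lab_irr vx vy xy nbv'.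
apply/lift/IHn => //.
  rewrite -ltnS; apply: leq_trans act; rewrite ltnS; apply: proper_card; apply/properP; split.
    apply/subsetP => a; rewrite inE => /orP[/h'E|/existsP[b /lab'E[av bv [ab|[abE xv vy']]]]].
    - by rewrite inE.
    - by rewrite inE; apply/orP; right; apply/existsP; exists b.
    - have : a \in [set x; y] by rewrite -abE set21.
      rewrite !inE => /orP[]/eqP->; apply/orP; right; apply/existsP; exists v => //.
      by rewrite lab_sym is_none_swap.
  exists v => //; rewrite inE negb_or h'v; apply/existsPn => b; apply/negP => /lab'E[].
  by rewrite eqxx.
move=> K4; apply: nK4.
have [/andP[xv vy']|nv] := boolP (r x v && r v y).
  apply: (suppress_Kn_subdivision (v := v) (x := x) (y := y) (r' := _)) K4 => //.
  by move=> a b /lab'E[av bv [ab|[abE _ _]]]; split=> //; [left|right].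
apply: has_Kn_subdivision_sub K4 => a b /lab'E[_ _ [//|[_ xv vy']]].
by case/negP: nv; rewrite /r xv.
Qed.
End Config.

(** * Triangles *)

Section Tuza.
Variable T : finType.
Implicit Types (r : rel T) (t : {set T}).

(** The matching is encoded by the set [D] of matched vertices and the partner map [f]. All edges
    get the label [Ledge] and no vertex a flag, so the score is [#|D| - 2 * #|C|]. *)
Lemma weak_Konig_Egervary r : symmetric r -> irreflexive r -> 2 < #|T| ->
    ~ has_Kn_subdivision 4 r ->
  exists (C D : {set T}) (f : T -> T),
    [/\ forall x, x \in D -> [/\ r x (f x), f x \in D & f (f x) = x],
        2 * #|C| <= #|D| &
        forall x y, r x y -> [\/ x \in C, y \in C | x \in D /\ f x = y]].
Proof.
move=> r_sym r_irr T3 nK4; pose lab x y := if r x y then Ledge else Lnone.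
have labE x y : ~~ is_none (lab x y) = r x y by rewrite /lab; case: (r x y).
have [|||t [p [[feas_tp _] score_tp]]] := @K4_free_solvable T lab pred0 T3.
- by move=> a b; rewrite /lab r_sym; case: (r a b).
- by move=> a; rewrite /lab r_irr.
- by move=> K4; apply: nK4; apply: has_Kn_subdivision_sub K4 => a b; rewrite labE.
pose f x := odflt x (p x).
have pf x : r x (f x) -> p x = Some (f x) by rewrite /f; case: (p x) => //=; rewrite r_irr.
(* Pointers that are not returned, or do not follow an edge, are discarded. *)
pose D := [set x | r x (f x) && (p (f x) == Some x)].
exists [set x | t x], D, f; split.
- move=> x; rewrite !inE => /andP[xfx /eqP pfx].
  by have -> : f (f x) = x by [rewrite {1}/f pfx]; rewrite [r (f x) x]r_sym xfx (pf x xfx) eqxx.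
- have D_sum : (\sum_q pair_gain lab t p q = #|D|%:Z)%R.
    rewrite -(pair_bigA _ (fun a b => pair_gain lab t p (a, b))) /=.
    rewrite -sum1_card (big_morph Posz PoszD (erefl _)) [RHS]big_mkcond /=.
    apply: eq_bigr => a _; rewrite (bigD1 (f a)) //= big1 ?GRing.addr0 => [|b /negPf bfa].
      rewrite /pair_gain /= /lab inE; case afa: (r a (f a)) => //=.
      by rewrite (pf a afa) eqxx /=; case: ifP.
    rewrite /pair_gain /lab /=; case: ifP => //= _; case: eqP => //= pab.
    by rewrite /f pab eqxx in bfa.
  move: score_tp; rewrite /score D_sum -(big_morph Posz PoszD (erefl _)).
  have -> : \sum_i cost (pred0 i) (t i) = #|[set x | t x]|.
    rewrite -sum1dep_card [RHS]big_mkcond; apply: eq_bigr => a _.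
    by rewrite /cost /= andbT; case: (t a).
  lia.
- move=> x y xy; have := feas_tp x y; rewrite /lab xy /= !inE.
  case/or3P=> [tx|ty|/andP[/eqP px /eqP py]]; [by constructor 1|by constructor 2|].
  have fx : f x = y by rewrite /f px.
  by constructor 3; rewrite fx xy py eqxx.
Qed.

(** * Triangles, packings and transversals *)

Lemma triangleP r t :
  reflect (#|t| = 3 /\ forall x y, x \in t -> y \in t -> x != y -> r x y) (triangle r t).
Proof.
apply: (iffP andP) => [[/eqP t3 /forall_inP tr]|[t3 tr]]; split=> //.
- by move=> x y /tr/forall_inP/[apply]/implyP.
- exact/eqP.
- by apply/forall_inP => x xt; apply/forall_inP => y yt; apply/implyP; apply: tr.
Qed.

Lemma tri_edges_disjoint t1 t2 :
    (forall x y, x \in t1 -> x \in t2 -> y \in t1 -> y \in t2 -> x = y) ->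
  tri_edges t1 :&: tri_edges t2 == set0.
Proof.
move=> dis; apply/eqP/setP => e; rewrite !inE; apply/negbTE/negP.
case/andP=> /imset2P[x y xt /[!inE] /andP[yt xy] ->].
case/imset2P=> [x' y' xt' /[!inE] /andP[yt' _] E].
case/eqP: xy; apply: dis => //.
  have: x \in [set x'; y'] by rewrite -E set21.
  by rewrite !inE => /orP[]/eqP->.
have: y \in [set x'; y'] by rewrite -E set22.
by rewrite !inE => /orP[]/eqP->.
Qed.

Lemma mem_tri_edges t x y : x \in t -> y \in t -> x != y -> [set x; y] \in tri_edges t.
Proof. by move=> xt yt xy; apply/imset2P; exists x y; rewrite ?inE ?yt. Qed.

Lemma mem_edges r x y : r x y -> [set x; y] \in edges r.
Proof. by move=> xy; apply/imset2P; exists x y; rewrite ?inE. Qed.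

(** Two triangles share an edge exactly when they share two distinct vertices. *)
Lemma tri_packingP r (S : {set {set T}}) :
  reflect ((forall t, t \in S -> triangle r t) /\
           (forall t1 t2, t1 \in S -> t2 \in S -> t1 != t2 ->
              forall x y, x \in t1 -> x \in t2 -> y \in t1 -> y \in t2 -> x = y))
          (tri_packing r S).
Proof.
apply: (iffP andP) => [[/forall_inP tr /forall_inP dis]|[tr dis]]; split=> //.
- move=> t1 t2 S1 S2 ne x y x1 x2 y1 y2; apply/eqP; apply: contraT => xy.
  have /forall_inP/(_ t2 S2)/implyP/(_ ne)/eqP/setP/(_ [set x; y]) := dis t1 S1.
  by rewrite !inE !mem_tri_edges.
- exact/forall_inP.
- apply/forall_inP => t1 S1; apply/forall_inP => t2 S2; apply/implyP => ne.
  by apply: tri_edges_disjoint => x y x1 x2 y1 y2; apply: (dis t1 t2).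
Qed.

(** Induction on the number of adjacent ordered pairs; the hypothesis on links passes to
    subgraphs. *)
Lemma link_K4_free_Tuza r : symmetric r -> irreflexive r ->
    (forall v, ~ has_Kn_subdivision 4 (link r v)) ->
  exists Y S : {set {set T}}, [/\ tri_transversal r Y, tri_packing r S & #|Y| <= 2 * #|S|].
Proof.
elim: {r}_.+1 {-2}r (ltnSn #|[set q : T * T | r q.1 q.2]|) => // n IHn r rn r_sym r_irr nK4.
have [tf|] := boolP (triangle_free r).
  exists set0, set0; rewrite !cards0; split=> //.
    rewrite /tri_transversal sub0set /=; apply/forallP => t.
    have /forallP/(_ t) := tf; apply: contra => /triangleP[t3 tr].
    by apply/triangleP; split=> // x y xt yt /(tr x y xt yt)/andP[].
  by apply/tri_packingP; split=> [t|t1 t2]; rewrite inE.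
rewrite negb_forall => /existsP[t0 /negPn/triangleP[t03 t0r]].
have T3 : 2 < #|T| by rewrite -t03 max_card.
(* Any vertex of a triangle serves: its edge to [w] is deleted, so the induction measure drops. *)
have [v vt0] : exists v, v \in t0 by apply/set0Pn; rewrite -card_gt0 t03.
have [w wt0 wv] : exists2 w, w \in t0 & v != w.
  have /set0Pn[w] : t0 :\ v != set0.
    by rewrite -card_gt0; have := cardsD1 v t0; rewrite vt0 t03; lia.
  by rewrite !inE eq_sym => /andP[wv wt0]; exists w.
have L_sym : symmetric (link r v) by move=> x y; rewrite /link [r x y]r_sym andbCA.
have L_irr : irreflexive (link r v) by move=> x; rewrite /link r_irr !andbF.
have [C [D [f [Df CD cover]]]] := weak_Konig_Egervary L_sym L_irr T3 (nK4 v).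
pose M := [set [set x; f x] | x in D].
have Mmem m x : m \in M -> x \in m -> x \in D /\ m = [set x; f x].
  case/imsetP=> y yD ->; case: (Df y yD) => _ fyD ffy.
  by rewrite !inE => /orP[]/eqP->; split=> //; rewrite ffy setUC.
have Mmeet m1 m2 x : m1 \in M -> m2 \in M -> x \in m1 -> x \in m2 -> m1 = m2.
  by move=> M1 M2 /(Mmem _ _ M1)[_ ->] /(Mmem _ _ M2)[_ ->].
have ME m : m \in M -> exists x, [/\ x \in D, m = [set x; f x], r v x, r v (f x) & r x (f x)].
  by case/imsetP=> x xD ->; exists x; case: (Df x xD) => /and3P[].
have M2 : #|M| * 2 = #|D|.
  apply/esym/card_uniform_partition.
    move=> m /ME[x [_ -> _ _ xfx]]; rewrite cards2; case: eqP xfx => // <-.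
    by rewrite r_irr.
  apply/and3P; split.
  - apply/eqP/setP => x; apply/bigcupP/idP => [[m mM xm]|xD].
      by case: (Mmem m x mM xm).
    by exists [set x; f x]; [apply: imset_f | rewrite set21].
  - apply/trivIsetP => m1 m2 M1 M2 ne; rewrite -setI_eq0.
    apply: contraNT ne => /set0Pn[x /setIP[x1 x2]]; apply/eqP; exact: Mmeet x1 x2.
  - by apply/negP => /ME[x [_ /setP/(_ x)]]; rewrite !inE eqxx.
pose r' x y := [&& r x y, x != v, y != v & [set x; y] \notin M].
have r'_sym : symmetric r'.
  by move=> x y; rewrite /r' [r x y]r_sym setUC; congr (_ && _); rewrite andbCA.
have r'_irr : irreflexive r' by move=> x; rewrite /r' r_irr.
have r'r : subrel r' r by move=> x y /andP[].
have [||Y' [S' [/andP[Y'e Y'tf] /tri_packingP[S'tr S'dis] Y'S']]] := IHn r' _ r'_sym r'_irr.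
- rewrite -ltnS; apply: leq_trans rn; rewrite ltnS; apply: proper_card; apply/properP; split.
    by apply/subsetP => q; rewrite !inE => /r'r.
  by exists (v, w); rewrite !inE /= ?(t0r v w) // /r' eqxx andbF.
- move=> u K4; apply: (nK4 u); apply: has_Kn_subdivision_sub K4 => x y.
  by case/and3P=> /r'r ux /r'r uy /r'r xy; rewrite /link ux uy.
pose N := [set v |: m | m in M].
have MvN m : m \in M -> v \notin m.
  case/ME => x [_ -> vx vfx _]; rewrite !inE negb_or.
  by apply/andP; split; [apply: contraTneq vx => <- | apply: contraTneq vfx => <-]; rewrite r_irr.
have S'v t x : t \in S' -> x \in t -> x != v.
  move=> /S'tr/triangleP[t3 tr] xt.
  have /set0Pn[y] : t :\ x != set0.
    by rewrite -card_gt0; have := cardsD1 x t; rewrite xt t3; lia.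
  by rewrite !inE eq_sym => /andP[xy yt]; have /and4P[] := tr x y xt yt xy.
have NE : #|N| = #|M|.
  apply: card_in_imset => m1 m2 m1M m2M E.
  by rewrite -(setU1K (MvN _ m1M)) E setU1K // MvN.
have S'N : S' :&: N = set0.
  apply/setP => t; rewrite !inE; apply/negbTE/negP => /andP[tS' /imsetP[m _ tE]].
  by have := S'v t v tS'; rewrite tE setU11 eqxx => /(_ isT).
(* Intersecting [C] with the neighbourhood of [v] keeps the transversal inside [edges r]. Since
   [#|C| <= #|M|], it grows by at most [2 * #|M|] while the packing grows by [#|M|]. *)
exists (Y' :|: M :|: [set [set v; c] | c in C :&: [set c | r v c]]), (S' :|: N); split.
- apply/andP; split.
    rewrite !subUset; apply/andP; split; [apply/andP; split|]; apply/subsetP => e.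
    + move/(subsetP Y'e)/imset2P=> [x y _ /[!inE] /andP[_ xy] ->].
      by apply: mem_edges; apply: r'r.
    + by case/ME => x [_ -> _ _ xfx]; apply: mem_edges.
    + by case/imsetP=> c /[!inE] /andP[_ vc] ->; apply: mem_edges.
  apply/forallP => t; apply/negP => /triangleP[t3 tr].
  have [vt|vt] := boolP (v \in t).
    have /cards2P[a [b [ab tE]]] : #|t :\ v| == 2.
      by apply/eqP; have := cardsD1 v t; rewrite vt t3; lia.
    have: a \in t :\ v by rewrite tE set21.
    have: b \in t :\ v by rewrite tE set22.
    rewrite !inE ![_ == v]eq_sym => /andP[vb bt] /andP[va at_].
    have /andP[rva] := tr v a vt at_ va; rewrite !inE !negb_or => /andP[_ nva].
    have /andP[rvb] := tr v b vt bt vb; rewrite !inE !negb_or => /andP[_ nvb].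
    have /andP[rab] := tr a b at_ bt ab; rewrite !inE !negb_or => /andP[/andP[_ nab] _].
    have [aC|bC|[aD fab]] : [\/ a \in C, b \in C | a \in D /\ f a = b].
    + by apply: cover; rewrite /link rva rvb.
    + by case/negP: nva; apply: imset_f; rewrite !inE aC.
    + by case/negP: nvb; apply: imset_f; rewrite !inE bC.
    + by case/negP: nab; rewrite -fab; apply: imset_f.
  have /forallP/(_ t)/triangleP[] := Y'tf; split=> // x y xt yt xy.
  have /andP[rxy] := tr x y xt yt xy; rewrite !inE !negb_or => /andP[/andP[nY nM] _].
  rewrite /del_edges /r' rxy nY nM !andbT /=.
  by apply/andP; split; [apply: contraNneq vt => <- | apply: contraNneq vt => <-].
(* A triangle of [S'] avoids [v] and the edges in [M], so it cannot contain both ends of [m]. *)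
- have meet1 t m x y : t \in S' -> m \in M -> x \in t -> x \in v |: m -> y \in t ->
      y \in v |: m -> x = y.
    move=> tS' mM xt; rewrite !in_setU1 (negPf (S'v t x tS' xt)) /= => xm yt.
    rewrite (negPf (S'v t y tS' yt)) /= => ym; apply/eqP; apply: contraT => xy.
    have /triangleP[_ tr] := S'tr t tS'; have /and4P[_ _ _] := tr x y xt yt xy.
    have [_ mE] := Mmem m x mM xm; suff -> : [set x; y] = m by rewrite mM.
    by move: ym; rewrite mE !inE eq_sym (negPf xy) /= => /eqP ->.
  apply/tri_packingP; split=> [t|t1 t2].
    rewrite inE => /orP[/S'tr/triangleP[t3 tr]|/imsetP[m mM ->]].
      by apply/triangleP; split=> // x y xt yt /(tr x y xt yt)/r'r.
    have [x [xD mE vx vfx xfx]] := ME m mM; apply/triangleP; split.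
      rewrite cardsU1 (MvN m mM) mE cards2; case: eqP xfx => // <-.
      by rewrite r_irr.
    move=> a b; rewrite mE !inE => /or3P[]/eqP-> /or3P[]/eqP->;
      by rewrite ?eqxx // [r _ _]r_sym.
  rewrite !inE => /orP[S1|/imsetP[m1 M1 ->]] /orP[S2|/imsetP[m2 M2' ->]] ne x y x1 x2 y1 y2.
  + exact: (S'dis t1 t2).
  + exact: (meet1 t1 m2).
  + exact: (meet1 t2 m1).
  + have m12 z : z != v -> z \in v |: m1 -> z \in v |: m2 -> v |: m1 = v |: m2.
      move=> zv; rewrite !in_setU1 (negPf zv) /= => z1 z2.
      by congr (_ |: _); apply: Mmeet z1 z2.
    have [xv|xv] := eqVneq x v; last by rewrite (m12 x) ?eqxx in ne.
    have [yv|yv] := eqVneq y v; first by rewrite xv yv.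
    by rewrite (m12 y) ?eqxx in ne.
- rewrite (cardsU S' N) S'N cards0 subn0 NE.
  have h1 := leq_card_setU (Y' :|: M) [set [set v; c] | c in C :&: [set c | r v c]].
  have h2 := leq_card_setU Y' M.
  have h3 := leq_imset_card (fun c => [set v; c]) (C :&: [set c | r v c]).
  have h4 := subset_leq_card (subsetIl C [set c | r v c]).
  apply: leq_trans h1 (leq_trans (leq_add h2 (leq_trans h3 h4)) _).
  have CM : #|C| <= #|M| by rewrite -(leq_pmul2l (isT : 0 < 2)) (leq_trans CD) // -M2 mulnC.
  by rewrite mulnDr -addnA leq_add // mul2n -addnn leq_add2l.
Qed.

Lemma bigmin_leq (I : eqType) (s : seq I) (P : pred I) (F : I -> nat) x0 i :
  i \in s -> P i -> \big[minn/x0]_(j <- s | P j) F j <= F i.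
Proof.
elim: s => // j s IHs; rewrite inE big_cons => /predU1P[<- ->|si Pi]; first exact: geq_minl.
by case: ifP => _; [apply: leq_trans (geq_minr _ _) _|]; apply: IHs.
Qed.

Lemma tau_leq r (Y : {set {set T}}) : tri_transversal r Y -> tau r <= #|Y|.
Proof. by apply: bigmin_leq; rewrite mem_index_enum. Qed.
End Tuza.

Theorem theorem3p8 (T : finType) (e : rel T) :
  symmetric e -> irreflexive e ->
  ~ has_K5_subdivision e ->
  tau e <= 2 * nu e.
Proof.
move=> e_sym e_irr nK5.
have [|Y [S [trY packS YS]]] := link_K4_free_Tuza e_sym e_irr.
  by move=> v K4; apply: nK5; apply: link_Kn_subdivision K4.
apply: leq_trans (tau_leq trY) (leq_trans YS _).
by rewrite leq_mul2l /= /nu; apply: leq_bigmax_cond.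
Qed.
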